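(* Let $N\ge 2$, let $K\in\mathcal K^{ss}_{(o)}$ and let $0<R\le\infty$. Assume that $A,B,H\in C^1(0,R)$ and $H=AB$. Then, for every $u\in C_c^\infty(B_R^K\setminus\{o\})\setminus\{0\}$ such that $\|A\mathcal R_K(u)\|>0$ and $\|Bu\|>0$, $$\Big(\int_{B_R^K}|A\mathcal R_K(u)|^2dx\Big)^{\frac12}\Big(\int_{B_R^K}B^2u^2dx\Big)^{\frac12}=\frac12\int_{B_R^K}\operatorname{div}\big(H(\|x\|_K)\sigma_K(x)\big)u^2dx+\frac12\int_{B_R^K}\left|\frac{\|Bu\|^{\frac12}A\mathcal R_K(u)}{\|A\mathcal R_K(u)\|^{\frac12}}+\frac{\|A\mathcal R_K(u)\|^{\frac12}Bu}{\|Bu\|^{\frac12}}\right|^2dx,$$ where $A$ and $B$ multiplying functions of $x$ are evaluated at $\|x\|_K$.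
   Context: $N\ge2$ is an integer and $o$ is the origin of $\mathbb R^N$. A convex body is a compact convex subset of $\mathbb R^N$ with non-empty interior. $\mathcal K^{ss}_{(o)}$ is the set of convex bodies $K\subset\mathbb R^N$ that contain $o$ in their interior, are smooth (each boundary point has a unique outer unit normal vector) and strictly convex ($\partial K$ contains no line segment). $K$ is not assumed origin-symmetric. The Minkowski functional of $K$ is $\|x\|_K=\inf\{\lambda\ge0: x\in\lambda K\}$. For $x\ne o$, $\sigma_K(x)=x/\|x\|_K$, and the anisotropic radial derivative is $\mathcal R_K(u)(x)=\nabla u(x)\cdot\sigma_K(x)=\frac{x\cdot\nabla u(x)}{\|x\|_K}$. For $0<R\le\infty$, $B_R^K=\{x\in\mathbb R^N:\|x\|_K<R\}$. The unsubscripted norm $\|\cdot\|$ is the $L^2$ norm (here over $B_R^K$). $C^1(0,R)$ is the set of real functions on $(0,R)$ with continuous first derivative, and $C_c^\infty(\Omega)$ is the set of real-valued smooth functions with compact support in $\Omega$. *)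

(* Defs.v *)
(* R^N is 'rV[R]_N; its library norm is the sup norm, used here only for the
   topology. *)
From HB Require Import structures.
From mathcomp Require Import all_boot all_order all_algebra.
From mathcomp Require Import all_classical all_reals all_analysis.

Set Implicit Arguments.
Unset Strict Implicit.
Unset Printing Implicit Defensive.

Import Order.TTheory GRing.Theory Num.Theory.
Import numFieldNormedType.Exports.

Local Open Scope classical_set_scope.
Local Open Scope ring_scope.

(* The sigma-algebra generated by the coordinates, i.e. the Borel one. *)
Definition measure_rV_display : measure_display.
Proof. exact: default_measure_display. Qed.

Section measurable_rV.
Variables (R : realType) (n : nat).

Definition rV_coord (i : 'I_n) (x : 'rV[R]_n) : measurableTypeR R := x ord0 i.

Let rV_set0 : g_sigma_preimage rV_coord set0.
Proof. exact: sigma_algebra0. Qed.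

Let rV_setC A : g_sigma_preimage rV_coord A -> g_sigma_preimage rV_coord (~` A).
Proof. exact: sigma_algebraC. Qed.

Let rV_bigcup (F : (set 'rV[R]_n)^nat) :
  (forall i, g_sigma_preimage rV_coord (F i)) ->
  g_sigma_preimage rV_coord (\bigcup_i (F i)).
Proof. exact: sigma_algebra_bigcup. Qed.

HB.instance Definition _ := @isMeasurable.Build measure_rV_display
  'rV[R]_n (g_sigma_preimage rV_coord) rV_set0 rV_setC rV_bigcup.

End measurable_rV.

Section lebesgue_rV.
Variable R : realType.

Lemma measurable_rV_coord n (i : 'I_n) :
  measurable_fun [set: 'rV[R]_n] (@rV_coord R n i).
Proof.
move=> _ Y mY; rewrite setTI; apply: sub_sigma_algebra => /=.
rewrite -bigcup_seq/=; exists i => /=; first by rewrite mem_index_enum.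
by exists Y => //; rewrite setTI.
Qed.

Lemma measurable_fun_rVP d (T : measurableType d) n (f : T -> 'rV[R]_n) :
  (forall i, measurable_fun [set: T] (rV_coord i \o f)) ->
  measurable_fun [set: T] f.
Proof.
move=> mf _ A mA; rewrite setTI.
suff : (@measurable _ 'rV[R]_n) `<=` [set A | measurable (f @^-1` A)] by exact.
apply: smallest_sub.
  split => /=; first by rewrite preimage_set0.
    by move=> B mB; rewrite setTD preimage_setC; exact: measurableC.
  by move=> F mF; rewrite preimage_bigcup; exact: bigcup_measurable.
move=> B; rewrite /= -bigcup_seq => -[i _ [C mC <-]] /=.
by rewrite setTI -comp_preimage -[X in measurable X]setTI; exact: mf.
Qed.

Definition rV_cons n (p : measurableTypeR R * 'rV[R]_n) : 'rV[R]_n.+1 :=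
  \row_i oapp (p.2 ord0) p.1 (unlift ord0 i).

Lemma measurable_rV_cons n : measurable_fun setT (@rV_cons n).
Proof.
apply: measurable_fun_rVP => i; case: (unliftP ord0 i) => [j|] ->.
  rewrite (_ : _ \o _ = @rV_coord R n j \o snd).
    by apply: measurableT_comp => //; exact: measurable_rV_coord.
  by apply/funext => p; rewrite /rV_cons /rV_coord /= mxE liftK.
rewrite (_ : _ \o _ = fst) //.
by apply/funext => p; rewrite /rV_cons /rV_coord /= mxE unlift_none.
Qed.

Definition rV_uncons n (x : 'rV[R]_n.+1) : measurableTypeR R * 'rV[R]_n :=
  (x ord0 ord0, \row_i x ord0 (lift ord0 i)).

Lemma rV_consK n : cancel (@rV_cons n) (@rV_uncons n).
Proof.
move=> [a x]; congr pair; first by rewrite mxE unlift_none.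
by apply/rowP => i; rewrite !mxE liftK.
Qed.

Lemma rV_unconsK n : cancel (@rV_uncons n) (@rV_cons n).
Proof.
move=> x; apply/rowP => i; rewrite !mxE.
by case: (unliftP ord0 i) => [j|] -> /=; rewrite ?mxE.
Qed.

Lemma measurable_rV_uncons n : measurable_fun setT (@rV_uncons n).
Proof.
apply/measurable_fun_pairP; split; first exact: measurable_rV_coord.
apply: measurable_fun_rVP => i.
rewrite (_ : _ \o _ = @rV_coord R n.+1 (lift ord0 i)).
  exact: measurable_rV_coord.
by apply/funext => x; rewrite /rV_coord /= mxE.
Qed.

Section step.
Local Open Scope ereal_scope.
Variables (n : nat) (mu : {sigma_finite_measure set 'rV[R]_n -> \bar R}).

Definition lebesgue_rVS : set 'rV[R]_n.+1 -> \bar R :=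
  pushforward (@lebesgue_measure R \x mu) (@rV_cons n).

HB.instance Definition _ := Measure.copy lebesgue_rVS
  (measure_function_pushforward__canonical__measure_function_Measure
    (@lebesgue_measure R \x mu) (@measurable_rV_cons n)).

Let lebesgue_rVS_sigma_finite : sigma_finite setT lebesgue_rVS.
Proof.
have /sigma_finiteP[F [TF ndF Foo]] := sigma_finiteT (@lebesgue_measure R).
have /sigma_finiteP[G [TG ndG Goo]] := sigma_finiteT mu.
exists (fun k => @rV_uncons n @^-1` (F k `*` G k)).
  apply/esym/seteqP; split=> // x _.
  have [i _ Fi] : (\bigcup_k F k) (rV_uncons x).1 by rewrite -TF.
  have [j _ Gj] : (\bigcup_k G k) (rV_uncons x).2 by rewrite -TG.
  exists (maxn i j) => //; split.
  - by move: Fi; apply/subsetPset/ndF/leq_maxl.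
  - by move: Gj; apply/subsetPset/ndG/leq_maxr.
move=> k; have [mF Fk] := Foo k; have [mG Gk] := Goo k; split.
  by rewrite -[X in measurable X]setTI; apply: measurable_rV_uncons => //;
    exact: measurableX.
rewrite /lebesgue_rVS /pushforward -comp_preimage.
rewrite (_ : _ \o _ = id) ?preimage_id; last first.
  by apply/funext => p; exact: rV_consK.
by rewrite product_measure1E// lte_mul_pinfty// ge0_fin_numE.
Qed.

HB.instance Definition _ :=
  Measure_isSigmaFinite.Build _ _ _ lebesgue_rVS lebesgue_rVS_sigma_finite.

End step.

Fixpoint lebesgue_rV (n : nat) : {sigma_finite_measure set 'rV[R]_n -> \bar R} :=
  if n is n'.+1 then lebesgue_rVS (lebesgue_rV n') else \d_(0 : 'rV[R]_0).

Lemma lebesgue_rV_box n (A : 'I_n -> set (measurableTypeR R)) :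
  (forall i, measurable (A i)) ->
  lebesgue_rV n [set x | forall i, A i (x ord0 i)] =
  (\prod_(i < n) lebesgue_measure (A i))%E.
Proof.
elim: n A => [|n IHn] A mA.
  by rewrite big_ord0 /= diracE mem_set// => -[].
rewrite big_ord_recl -IHn//= /lebesgue_rVS /pushforward -product_measure1E//.
  congr (_ _); apply/seteqP; split=> [[a x] /= Ax|[a x] /= [Aa Ax] i].
    split=> [|i]; first by have := Ax ord0; rewrite mxE unlift_none.
    by have := Ax (lift ord0 i); rewrite mxE liftK.
  by rewrite mxE; case: (unliftP ord0 i) => [j|] ->.
rewrite [X in measurable X](_ : _ = \bigcap_(i in [set: 'I_n])
    (@rV_coord R n i @^-1` A (lift ord0 i))); last first.
  by apply/seteqP; split => [x Ax i _|x Ax i]; exact: Ax.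
apply: fin_bigcap_measurable => // i _.
by rewrite -[X in measurable X]setTI; exact: measurable_rV_coord.
Qed.

End lebesgue_rV.

Section anisotropic.
Variables (R : realType) (N : nat).
Implicit Types (K Omega : set 'rV[R]_N) (x y n : 'rV[R]_N) (u : 'rV[R]_N -> R).

Definition dotmul x y : R := \sum_(i < N) x ord0 i * y ord0 i.

Definition boundary K : set 'rV[R]_N := closure K `\` K°.

Definition convex_body K := [/\ compact K, convex_set K & K° !=set0].

Definition outer_unit_normal K x n :=
  dotmul n n = 1 /\ forall y, K y -> dotmul n (y - x) <= 0.

Definition smooth_body K :=
  forall x, boundary K x -> exists! n, outer_unit_normal K x n.

Definition strictly_convex_body K := forall x y, x != y ->
  ~ [set (1 - t) *: x + t *: y | t in `[0, 1]] `<=` boundary K.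

Definition Kss_o K :=
  [/\ convex_body K, K° 0, smooth_body K & strictly_convex_body K].

Definition minkowski_fun K x : R :=
  inf [set l : R | 0 <= l /\ [set l *: y | y in K] x].

(* As (0 : R)^-1 = 0, this is 0 at the origin. *)
Definition sigma_body K x : 'rV[R]_N := (minkowski_fun K x)^-1 *: x.

Definition aball K (rho : \bar R) : set 'rV[R]_N :=
  [set x | ((minkowski_fun K x)%:E < rho)%E].

Definition partial_derive (i : 'I_N) u x : R := 'D_(delta_mx ord0 i) u x.

Definition grad u x : 'rV[R]_N := \row_i partial_derive i u x.

Definition radial_derive K u x : R := dotmul (grad u x) (sigma_body K x).

Definition divergence (F : 'rV[R]_N -> 'rV[R]_N) x : R :=
  \sum_(i < N) partial_derive i (fun y => F y ord0 i) x.

Fixpoint Ck (k : nat) u : Prop :=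
  continuous u /\
  if k is k'.+1 then
    forall i, (forall x, derivable u x (delta_mx ord0 i)) /\
      Ck k' (partial_derive i u)
  else True.

(* C_c^oo(Omega) for Omega open, its elements being extended by 0 to R^N. *)
Definition test_function Omega u :=
  [/\ forall k, Ck k u, compact (closure [set x | u x != 0])
    & closure [set x | u x != 0] `<=` Omega].

(* C^1(0, rho) for functions on R whose values outside (0, rho) are irrelevant. *)
Definition C1_open0 (rho : \bar R) (f : R -> R) := forall r : R,
  0 < r -> (r%:E < rho)%E -> derivable f r 1 /\ {for r, continuous (derive1 f)}.

Definition L2norm (D : set 'rV[R]_N) (f : 'rV[R]_N -> R) : R :=
  Num.sqrt (\int[lebesgue_rV R N]_(x in D) `|f x| ^+ 2).

End anisotropic.

(* Main.v *)
Require Import Defs.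
From mathcomp Require Import all_boot all_order all_algebra.
From mathcomp Require Import all_classical all_reals all_analysis.
From mathcomp Require Import measurable_realfun lra ring.

Import Order.TTheory GRing.Theory Num.Theory.
Import numFieldNormedType.Exports.
Set Implicit Arguments.
Unset Strict Implicit.

Local Open Scope classical_set_scope.
Local Open Scope ring_scope.

(** Put [g] for the Minkowski functional of [K], [X] for [A(g) R_K u] and [Y]
    for [B(g) u], with norms [a] and [b].  Expanding the last square,
<<
      |sqrt b X / sqrt a + sqrt a Y / sqrt b|^2
        = (b / a) X^2 + (a / b) Y^2 + 2 X Y,
>>
    and integrating, the identity becomes [int div F u^2 + 2 int X Y = 0], where
    [F x = H(g x) sigma_K x] ([mul_L2norm]).  As [X Y = u (F . grad u)], this says
    that the integral of [div (u^2 F)] vanishes ([flux_integral_eq0]).  Two facts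
    are needed for that.

    The field [u^2 F] has compact support away from the origin, and it is of
    class C^1 because [g] is: for [x <> 0] the unique outer normal of [K] at
    [x / g x], suitably scaled, is the only vector [q] with [q . z <= g z] for all
    [z] and [q . x = g x].  Uniqueness and compactness make this vector depend
    continuously on [x] ([continuous_minkowski_grad]); then the subgradient
    inequalities at [x] and at [x + h v] enclose the difference quotient of [g]
    between two quantities with the same limit, so that this vector is the
    gradient of [g] ([is_derive_minkowski]).

    The integral of a partial derivative [d_i f] of a compactly supported C^1
    function vanishes: the integral of [f (x + t e_i)] does not depend on [t],
    by translation invariance of Lebesgue measure, and its derivative at [t = 0]
    can be computed under the integral sign ([Rintegral_derive_eq0]). *)

(** * Continuity of real functions on a topological space *)

(** The space is abstract in these closure properties so that neighborhoods stay
    folded when they are applied to row vectors. *)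
Lemma continuous_at_sum (R : realType) (V : topologicalType) n
    (f : 'I_n -> V -> R) (x : V) :
  (forall i, {for x, continuous (f i)}) ->
  {for x, continuous (fun y => \sum_(i < n) f i y)}.
Proof.
by move=> cf; apply: cvg_big => [|i _]; [exact: add_continuous|exact: cf].
Qed.

Lemma continuous_atM (R : realType) (V : topologicalType) (f g : V -> R) (x : V) :
  {for x, continuous f} -> {for x, continuous g} ->
  {for x, continuous (fun y => f y * g y)}.
Proof. exact: continuousM. Qed.

Lemma continuous_atN (R : realType) (V : topologicalType) (f : V -> R) (x : V) :
  {for x, continuous f} -> {for x, continuous (fun y => - f y)}.
Proof. exact: continuousN. Qed.

Lemma near_dist (R : realType) (V : normedModType R) (x : V) (d : R) :
  0 < d -> \forall y \near x, `|x - y| < d.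
Proof.
by move=> d0; apply/nbhs_ballP; exists d => // y; rewrite -ball_normE.
Qed.

(** Products of a function that is regular only near the support of another
    with that other function are handled by this gluing principle. *)
Lemma continuous_extend0 (R : realType) (V : topologicalType) (S : set V)
    (f : V -> R) : closed S -> (forall x, S x -> {for x, continuous f}) ->
  (forall x, ~ S x -> f x = 0) -> continuous f.
Proof.
move=> cS fS f0 x; have [/fS //|nSx] := pselect (S x).
have nS : \forall y \near x, cst 0 y = f y.
  have : nbhs x (~` S) by apply: open_nbhs_nbhs; split=> //; exact: closed_openC.
  by apply: filterS => y nSy; rewrite f0.
rewrite /continuous_at f0//.
by apply: cvg_trans (near_eq_cvg nS) _; exact: cvg_cst.
Qed.

Lemma continuous_atD (R : realType) (V : topologicalType) (f g : V -> R) (x : V) :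
  {for x, continuous f} -> {for x, continuous g} ->
  {for x, continuous (fun y => f y + g y)}.
Proof. exact: continuousD. Qed.

(** * Borel sets of R^n *)

Section rV_borel.
Variables (R : realType) (n : nat).
Implicit Types (x v : 'rV[R]_n).

Lemma ball_rVP x (e : R) v : 0 < e ->
  ball x e v <-> forall i, `|x ord0 i - v ord0 i| < e.
Proof.
move=> e0; split=> [[_ +] i|xv]; first by move/(_ ord0 i).
by split=> // i j; rewrite ord1; exact: xv.
Qed.

Lemma norm_rV_coord x i : `|x ord0 i| <= `|x|.
Proof.
rewrite [leRHS]/Num.Def.normr /= mx_normrE; apply: (le_trans _ (le_bigmax _ _ (ord0, i))).
by [].
Qed.

Definition rV_box (A : 'I_n -> set (measurableTypeR R)) : set 'rV[R]_n :=
  [set x | forall i, A i (x ord0 i)].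

Lemma measurable_rV_box A : (forall i, measurable (A i)) -> measurable (rV_box A).
Proof.
move=> mA; rewrite (_ : rV_box A =
    \bigcap_(i in [set: 'I_n]) (@rV_coord R n i @^-1` A i)); last first.
  by apply/seteqP; split => [x Ax i _|x Ax i]; exact: Ax.
apply: fin_bigcap_measurable => // i _.
by rewrite -[X in measurable X]setTI; exact: measurable_rV_coord.
Qed.

(** An open set is the countable union of the rational boxes it contains. *)
Lemma open_measurable_rV (U : set 'rV[R]_n) : open U -> measurable U.
Proof.
move=> oU.
pose I (p : 'rV[rat]_n * nat) :=
  rV_box (fun i => `]ratr (p.1 ord0 i) - p.2.+1%:R^-1,
                     ratr (p.1 ord0 i) + p.2.+1%:R^-1[%classic).
have -> : U = \bigcup_p (if `[< I p `<=` U >] then I p else set0).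
  apply/seteqP; split=> [x Ux|x [p _]]; last by case: asboolP => // + Ix; exact.
  have /nbhs_ballP[e /= e0 xeU] : nbhs x U by apply: open_nbhs_nbhs.
  have [k ke] : exists k : nat, k.+1%:R^-1 < e / 2.
    have e20 : 0 < e / 2 by lra.
    have [k _ /(_ k (leqnn k)) /= ?] := near_infty_natSinv_lt (PosNum e20).
    by exists k.
  have k0 : 0 < k.+1%:R^-1 :> R by rewrite invr_gt0.
  have /choice[q xq] i : exists q : rat, ratr q \in
      `](x ord0 i - k.+1%:R^-1), (x ord0 i + k.+1%:R^-1)[.
    have /rat_in_itvoo[q] : x ord0 i - k.+1%:R^-1 < x ord0 i + k.+1%:R^-1.
      by rewrite ltrD2l gtrN.
    by exists q.
  exists (\row_i q i, k) => //.
  have Ix : I (\row_i q i, k) x.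
    move=> i /=; rewrite in_itv/= mxE; have := xq i; rewrite in_itv/=.
    by set d := _^-1; move=> /andP[? ?]; apply/andP; split; lra.
  rewrite ifT//; apply/asboolP => y Iy; apply: xeU; apply/ball_rVP => // i.
  have := Iy i; have := Ix i; rewrite /= !in_itv/= !mxE.
  set d := _^-1 in ke k0 *; move=> /andP[? ?] /andP[? ?].
  by rewrite ltr_norml; apply/andP; split; lra.
apply: countable_bigcupT_measurable => [|p].
  exact: countableP.
by case: ifP => _ //; apply: measurable_rV_box => i; exact: measurable_itv.
Qed.

Lemma continuous_measurable_rV (f : 'rV[R]_n -> R) :
  continuous f -> measurable_fun setT f.
Proof.
move=> cf; apply: (measurability _ (measurable_realfun.RGenOInfty.measurableE R)).
move=> _ [_ [a ->] <-].
rewrite setTI; apply: open_measurable_rV.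
by apply: open_comp => // x _; exact: cf.
Qed.

End rV_borel.

(** * Lebesgue measure and translations *)

Section translation.
Variable R : realType.

Lemma measurable_shift (a : R) :
  measurable_fun setT (fun r : measurableTypeR R => r + a : measurableTypeR R).
Proof. by apply: measurable_funD. Qed.

Lemma lebesgue_measure_shift (a : R) (A : set (measurableTypeR R)) : measurable A ->
  lebesgue_measure ((fun r => r + a) @^-1` A) = lebesgue_measure A.
Proof.
move=> mA; apply/esym.
apply: (@lebesgue_measure_unique R
  (measure_function_pushforward__canonical__measure_function_Measure
    (@lebesgue_measure R) (measurable_shift a))) => // _ [[c d] _ <-].
rewrite /= /pushforward.
rewrite (_ : _ @^-1` _ = `](c - a), (d - a)]%classic); last first.
  by apply/seteqP; split => x /=; rewrite !in_itv/= ltrBlDr lerBrDr.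
rewrite !lebesgue_measure_itv/= !lte_fin ltrD2r.
by case: ifP => // _; rewrite -!EFinD opprB addrA subrK.
Qed.

Variable n : nat.
Implicit Types v : 'rV[R]_n.

Lemma measurable_translation v : measurable_fun setT (fun x : 'rV[R]_n => x + v).
Proof.
apply: measurable_fun_rVP => i.
rewrite (_ : _ \o _ = (fun r => r + v ord0 i) \o @rV_coord R n i).
  apply: measurableT_comp; first exact: measurable_shift.
  exact: measurable_rV_coord.
by apply/funext => x; rewrite /rV_coord /= mxE.
Qed.

Lemma measurable_rV_boxE : @measurable _ 'rV[R]_n =
  <<s [set rV_box A | A in [set A | forall i, measurable (A i)]] >>.
Proof.
apply/seteqP; split; last first.
  apply: smallest_sub; first exact: sigma_algebra_measurable.
  by move=> _ [A mA <-]; exact: measurable_rV_box.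
apply: smallest_sub; first exact: smallest_sigma_algebra.
move=> B; rewrite /= -bigcup_seq => -[i _ [Y mY <-]]; apply: sub_sigma_algebra.
exists (fun j => if j == i then Y else setT).
  by move=> j; case: ifP.
apply/seteqP; split => x; first by move=> /(_ i); rewrite eqxx.
by move=> [_ Yx] j; case: eqP => // ->.
Qed.

Lemma lebesgue_rV_box_fin (M : R) :
  (lebesgue_rV R n (rV_box (fun=> `[(- M)%R, M]%classic)) < +oo)%E.
Proof.
rewrite lebesgue_rV_box//.
suff /andP[] : (0 <= \prod_(i < n) lebesgue_measure
    (`[(- M)%R, M]%classic : set (measurableTypeR R)) < +oo)%E by [].
apply: (@big_ind _ (fun x : \bar R => 0 <= x < +oo)%E).
- by rewrite lee01 ltry.
- move=> x y /andP[x0 xy] /andP[y0 yy].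
  by rewrite mule_ge0// lte_mul_pinfty// ge0_fin_numE.
- move=> i _; rewrite measure_ge0/= lebesgue_measure_itv/=.
  by case: ifP => // _; rewrite -EFinD ltry.
Qed.

(** Both measures are finite on boxes and agree on them, and measurable boxes
    form a generating family closed under intersection. *)
Lemma lebesgue_rV_translation v (A : set 'rV[R]_n) : measurable A ->
  lebesgue_rV R n ((fun x => x + v) @^-1` A) = lebesgue_rV R n A.
Proof.
move=> mA; apply/esym.
apply: (@measure_unique _ _ _ _ (fun k => rV_box (fun=> `[- k%:R, k%:R]%classic))
  measurable_rV_boxE _ _ _ _
  (measure_function_pushforward__canonical__measure_function_Measure
    (lebesgue_rV R n) (measurable_translation v))) => //.
- move=> _ _ [B mB <-] [C mC <-]; exists (fun i => B i `&` C i).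
    by move=> i; exact: measurableI.
  by apply/seteqP; split => x; [move=> BC; split => i; have [] := BC i|
    move=> [Bx Cx] i; split].
- by move=> k; exists (fun=> `[- k%:R, k%:R]%classic).
- apply/seteqP; split => // x _.
  exists (Num.bound `|x|) => // i; rewrite /= in_itv/= -ler_norml.
  rewrite (le_trans (norm_rV_coord _ _))// ltW//.
  exact: archi_boundP.
- move=> _ [B mB <-]; rewrite /= /pushforward.
  rewrite (_ : _ @^-1` _ = rV_box (fun i => (fun r => r + v ord0 i) @^-1` B i)).
    rewrite !lebesgue_rV_box//; last first.
      by move=> i; rewrite -[X in measurable X]setTI; exact: measurable_shift.
    by apply: eq_bigr => i _; rewrite lebesgue_measure_shift.
  by apply/seteqP; split => x Bx i; have := Bx i; rewrite /= mxE.
- by move=> k; exact: lebesgue_rV_box_fin.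
Qed.

End translation.

(** * Integrals of compactly supported functions *)

Section compact_support.
Variables (R : realType) (n : nat).
Implicit Types (f : 'rV[R]_n -> R) (x v : 'rV[R]_n).
Local Notation mu := (lebesgue_rV R n).

Definition supported_in_ball f (M : R) := forall x, f x != 0 -> `|x| <= M.

Lemma compact_rV_ball (M : R) : compact [set x : 'rV[R]_n | `|x| <= M].
Proof.
apply: bounded_closed_compact.
  exists M; split; first exact: num_real.
  by move=> M' CM q /= qC; rewrite (le_trans qC)// ltW.
rewrite (_ : mkset _ = Num.norm @^-1` [set r : R | r <= M]) //.
apply: closed_comp => [q _|]; first exact: norm_continuous.
exact: closed_le.
Qed.

Lemma supported_bounded f M : continuous f -> supported_in_ball f M ->
  exists2 C : R, 0 <= C & forall x, `|f x| <= C.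
Proof.
move=> cf fM.
have cK : compact (f @` [set x : 'rV[R]_n | `|x| <= M]).
  apply: continuous_compact; last exact: compact_rV_ball.
  exact: continuous_subspaceT.
have [C [_ CK]] := compact_bounded cK.
exists (`|C| + 1) => [|x]; first by rewrite addr_ge0.
have [->|fx0] := eqVneq (f x) 0; first by rewrite normr0 addr_ge0.
apply: CK; first by rewrite ltr_pwDr// ler_norm.
by exists x => //; exact: fM.
Qed.

Lemma supported_integrable f M : continuous f -> supported_in_ball f M ->
  mu.-integrable setT (EFin \o f).
Proof.
move=> cf fM; have [C C0 fC] := supported_bounded cf fM.
pose B := rV_box (fun=> `[- M, M]%classic) : set 'rV[R]_n.
have mB : measurable B by exact: measurable_rV_box.
have : mu.-integrable B (EFin \o f).
  apply: measurable_bounded_integrable => //.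
  - exact: lebesgue_rV_box_fin.
  - by apply: measurable_funTS; exact: continuous_measurable_rV.
  - exists C; split; first exact: num_real.
    by move=> C' CC' x _ /=; rewrite (le_trans (fC x))// ltW.
move=> /(integrable_mkcond _ mB); congr (integrable _ _ _).
apply/funext => x; rewrite patchE; case: ifPn => //; rewrite notin_setE => Bx.
rewrite /=; have [->//|fx0] := eqVneq (f x) 0.
exfalso; apply: Bx => i /=; rewrite in_itv/= -ler_norml.
exact: le_trans (norm_rV_coord _ _) (fM _ fx0).
Qed.

Lemma supported_translation f M v : supported_in_ball f M ->
  supported_in_ball (fun x => f (x + v)) (M + `|v|).
Proof.
move=> fM x /fM xvM; rewrite -(addrK v x).
by rewrite (le_trans (ler_normB _ _))// lerD2r.
Qed.

Lemma continuous_translation f v : continuous f -> continuous (fun x => f (x + v)).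
Proof.
move=> cf x; apply: (@continuous_comp _ _ _ (fun x => x + v) f); last exact: cf.
by apply: (@cvgD _ _ _ (nbhs x)); [exact: cvg_id|exact: cvg_cst].
Qed.

Lemma Rintegral_translation f M v : continuous f -> supported_in_ball f M ->
  \int[mu]_x f (x + v) = \int[mu]_x f x.
Proof.
move=> cf fM; congr fine.
have := @integral_pushforward _ _ _ _ R _ (measurable_translation v) mu setT
  (EFin \o f).
rewrite preimage_setT => <- //; last 2 first.
- by apply/measurable_EFinP; exact: continuous_measurable_rV.
- apply: (@supported_integrable (fun x => f (x + v)) (M + `|v|)).
    exact: continuous_translation.
  exact: supported_translation.
apply: (@eq_measure_integral _ _ _ _ mu
  (measure_function_pushforward__canonical__measure_function_Measure
    mu (measurable_translation v))) => A mA _.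
exact: lebesgue_rV_translation.
Qed.

Lemma supported_derive f M v : supported_in_ball f M ->
  supported_in_ball (fun x => 'D_v f x) M.
Proof.
move=> fM x; apply: contraNT; rewrite -ltNge => xM; apply/eqP.
rewrite (@near_eq_derive _ _ _ f (cst 0)) ?derive_cst//.
have xM0 : 0 < `|x| - M by rewrite subr_gt0.
apply: (@filterS _ (nbhs x) _ _ _ _ (near_dist x xM0)) => y xy /=.
apply/eqP; apply: contraTT xy => /fM yM; rewrite -leNgt.
by have := ler_dist_dist x y; have := ler_norm (`|x| - `|y|); lra.
Qed.

Lemma derive1_line f v x (t : R) :
  derive1 (fun h : R => f (h *: v + x)) t = 'D_v f (t *: v + x).
Proof.
rewrite /derive1 /derive; set f1 := fun h => h^-1 *: _; set f2 := fun h => h^-1 *: _.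
by suff -> : f1 = f2 by []; apply/funext => h; rewrite /f1 /f2 /= scalerDl addrA.
Qed.

(** The integral of [x |-> f (t v + x)] is constant in [t], so its derivative at
    0 vanishes; it is also the integral of ['D_v f]. *)
Lemma Rintegral_derive_eq0 f M v : continuous f -> (forall x, derivable f x v) ->
  continuous (fun x => 'D_v f x) -> supported_in_ball f M ->
  \int[mu]_x 'D_v f x = 0.
Proof.
move=> cf df cdf fM.
have dfM := @supported_derive f M v fM.
have [C C0 dfC] := supported_bounded cdf dfM.
pose F (t : R) x := f (t *: v + x).
have FE t : F t = fun x => f (x + t *: v).
  by apply/funext => x; rewrite /F addrC.
(* For |t| < 1 the translates of 'D_v f are supported in the box B, hence
   dominated by C times its indicator. *)
pose B := rV_box (fun=> `[- (M + `|v|), M + `|v|]%classic) : set 'rV[R]_n.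
have mB : measurable B by exact: measurable_rV_box.
pose G := (fun=> C) \_ B.
have iG : mu.-integrable setT (EFin \o G).
  have : mu.-integrable B (EFin \o (fun=> C)).
    apply: measurable_bounded_integrable => //.
    - exact: lebesgue_rV_box_fin.
    - exists C; split; first exact: num_real.
      by move=> C' CC' x _ /=; rewrite ger0_norm// ltW.
  move=> /(integrable_mkcond _ mB); congr (integrable _ _ _).
  by apply/funext => x; rewrite /G /= !patchE; case: ifP.
have I0 : `]-1, 1[%classic (0 : R) by rewrite /= in_itv/=; lra.
have intF t : `]-1, 1[%classic (t : R) -> mu.-integrable setT (EFin \o F t).
  move=> _; rewrite FE; apply: (@supported_integrable _ (M + `|t *: v|)).
    exact: continuous_translation.
  exact: supported_translation.
have derF t x : `]-1, 1[%classic (t : R) -> setT x -> derivable (F ^~ x) t 1.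
  move=> _ _; apply/derivable1P.
  rewrite (_ : (fun h => _) = (fun h : R => f (h *: v + (t *: v + x)))).
    exact: (iffLR (derivable1P f (t *: v + x) v) (df _)).
  by apply/funext => h; rewrite /F [h%:A]mulr1 scalerDl addrA.
have G0 x : 0 <= G x by rewrite /G patchE; case: ifP.
have GF t x : `]-1, 1[%classic (t : R) -> setT x ->
    `|partial1of2 F t x| <= G x.
  rewrite /= in_itv/= => /andP[t1 t2] _; rewrite /partial1of2 derive1_line.
  rewrite /G patchE; case: ifPn => [_|]; first exact: dfC.
  rewrite notin_setE => Bx.
  have [->|/dfM tM] := eqVneq ('D_v f (t *: v + x)) 0; first by rewrite normr0.
  exfalso; apply: Bx => i /=; rewrite in_itv/= -ler_norml.
  apply: le_trans (norm_rV_coord _ _) _.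
  have -> : x = (t *: v + x) - t *: v by rewrite addrC addKr.
  rewrite (le_trans (ler_normB _ _))// lerD//.
  by rewrite normrZ ler_piMl// ler_norml; apply/andP; split; lra.
have := differentiation_under_integral measurableT I0 intF derF G0 iG GF.
have -> : (fun t => \int[mu]_(y in setT) F t y) = cst (\int[mu]_x f x).
  apply/funext => t; rewrite FE; exact: (Rintegral_translation _ cf fM).
rewrite derive1_cst => ->; apply: eq_Rintegral => x _.
by rewrite /partial1of2 /F derive1_line scale0r add0r.
Qed.

End compact_support.

(** * The Minkowski functional of a smooth body *)

Section dotmul.
Variables (R : realType) (N : nat).
Implicit Types (x y z : 'rV[R]_N).

Lemma dotmulDr x y z : dotmul x (y + z) = dotmul x y + dotmul x z.
Proof. by rewrite -big_split; apply: eq_bigr => i _; rewrite mxE mulrDr. Qed.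

Lemma dotmulZr (a : R) x y : dotmul x (a *: y) = a * dotmul x y.
Proof. by rewrite mulr_sumr; apply: eq_bigr => i _; rewrite mxE mulrCA. Qed.

Lemma dotmulC x y : dotmul x y = dotmul y x.
Proof. by apply: eq_bigr => i _; rewrite mulrC. Qed.

Lemma dotmulZl (a : R) x y : dotmul (a *: x) y = a * dotmul x y.
Proof. by rewrite dotmulC dotmulZr dotmulC. Qed.

Lemma dotmulBr x y z : dotmul x (y - z) = dotmul x y - dotmul x z.
Proof. by rewrite -scaleN1r dotmulDr dotmulZr mulN1r. Qed.

Lemma dotmul0l y : dotmul 0 y = 0.
Proof. by rewrite -(scale0r 0) dotmulZl mul0r. Qed.

Lemma dotmul_ge0 x : 0 <= dotmul x x.
Proof. by apply: sumr_ge0 => i _; rewrite -expr2 sqr_ge0. Qed.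

Lemma dotmul_eq0 x : (dotmul x x == 0) = (x == 0).
Proof.
apply/idP/eqP => [|->]; last by rewrite dotmul0l.
rewrite psumr_eq0 => [/allP x0|i _]; last by rewrite -expr2 sqr_ge0.
apply/rowP => i; rewrite mxE; apply/eqP; have := x0 i (mem_index_enum i).
by rewrite /= mulf_eq0 orbb.
Qed.

Lemma dotmul_delta x i : dotmul x (delta_mx ord0 i) = x ord0 i.
Proof.
rewrite /dotmul (bigD1 i)//= mxE !eqxx mulr1 big1 ?addr0// => j ji.
by rewrite mxE (negPf ji) mulr0.
Qed.

Lemma norm_dotmul x y : `|dotmul x y| <= N%:R * `|x| * `|y|.
Proof.
apply: (le_trans (ler_norm_sum _ _ _)).
rewrite -mulrA mulr_natl -[X in _ <= _ *+ X]card_ord -sumr_const.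
apply: ler_sum => i _.
by rewrite normrM ler_pM// norm_rV_coord.
Qed.

End dotmul.

Section minkowski.
Variables (R : realType) (N : nat) (K : set 'rV[R]_N).
Hypotheses (cK : compact K) (K0 : K° 0).
Hypothesis smoothK : smooth_body K.
Local Notation g := (minkowski_fun K).
Implicit Types (x y z v q : 'rV[R]_N).

Lemma minkowski_ball : exists2 r : R, 0 < r & forall x, `|x| < r -> K x.
Proof.
move: K0; rewrite /interior => /nbhs_ballP[r /= r0 rK]; exists r => // x xr.
by apply: rK; rewrite -ball_normE /= sub0r normrN.
Qed.

Lemma minkowski_bounded : exists2 M : R, 0 < M & forall x, K x -> `|x| <= M.
Proof.
have [M [_ MK]] := compact_bounded cK.
exists (`|M| + 1); first by rewrite ltr_wpDl.
by move=> x Kx; apply: MK => //; rewrite ltr_pwDr// ler_norm.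
Qed.

Lemma minkowski_has_inf x :
  has_inf [set l : R | 0 <= l /\ [set l *: y | y in K] x].
Proof.
split; last by exists 0 => l [].
have [r r0 rK] := minkowski_ball.
have l0 : 0 < (`|x| + 1) / r by rewrite divr_gt0// ltr_wpDl.
exists ((`|x| + 1) / r); split; first exact: ltW.
exists (((`|x| + 1) / r)^-1 *: x); last by rewrite scalerA divff ?scale1r// gt_eqF.
have nx1 : 0 < `|x| + 1 by rewrite ltr_wpDl.
apply: rK; rewrite normrZ gtr0_norm ?invr_gt0//.
rewrite (_ : _ * _ = r * (`|x| / (`|x| + 1))); last by field; rewrite !gt_eqF.
by rewrite -[ltRHS]mulr1 ltr_pM2l// ltr_pdivrMr// mul1r ltrDl.
Qed.

Lemma minkowski_le x (l : R) y : 0 <= l -> K y -> x = l *: y -> g x <= l.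
Proof.
move=> l0 Ky xE; apply: ge_inf; first by have [] := minkowski_has_inf x.
by split => //; exists y.
Qed.

Lemma minkowski_ge0 x : 0 <= g x.
Proof. by apply: lb_le_inf => [|l []//]; have [] := minkowski_has_inf x. Qed.

Lemma minkowski_gt0 x : x != 0 -> 0 < g x.
Proof.
move=> x0; have [M M0 KM] := minkowski_bounded.
apply: (@lt_le_trans _ _ (`|x| / M)); first by rewrite divr_gt0// normr_gt0.
apply: lb_le_inf => [|l [l0 [y Ky <-]]]; first by have [] := minkowski_has_inf x.
by rewrite ler_pdivrMr// normrZ ger0_norm// ler_wpM2l// KM.
Qed.

Lemma minkowski_0 : g 0 = 0.
Proof.
apply/eqP; rewrite eq_le minkowski_ge0 andbT.
by apply: (@minkowski_le _ _ 0) => //; [exact: interior_subset|rewrite scaler0].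
Qed.

Lemma minkowski_le_norm : exists2 C : R, 0 < C & forall x, g x <= C * `|x|.
Proof.
have [r r0 rK] := minkowski_ball.
exists (2 / r) => [|x]; first by rewrite divr_gt0.
have [->|x0] := eqVneq x 0; first by rewrite minkowski_0 normr0 mulr0.
have nx : 0 < `|x| by rewrite normr_gt0.
have l0 : 0 < 2 / r * `|x| by rewrite mulr_gt0// divr_gt0.
apply: (@minkowski_le _ _ ((2 / r * `|x|)^-1 *: x)).
- exact: ltW.
- apply: rK; rewrite normrZ gtr0_norm ?invr_gt0//.
  rewrite (_ : _ * _ = r / 2); last by field; rewrite !gt_eqF.
  by lra.
- by rewrite scalerA divff ?scale1r// gt_eqF.
Qed.

(** The infimum is attained because [K] is closed. *)
Lemma minkowski_attained x : x != 0 -> K ((g x)^-1 *: x).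
Proof.
move=> x0; have gx0 := minkowski_gt0 x0.
have clK : closed K by apply: compact_closed cK; exact: norm_hausdorff.
apply: clK => U.
have /= cl : (fun l : R => l^-1 *: x) @ g x --> (g x)^-1 *: x.
  by apply: cvgZl; apply: cvgV; rewrite ?gt_eqF.
move=> /cl /nbhs_ballP[e /= e0 eU].
have [l [l0 [y Ky xE]] lg] := inf_adherent e0 (minkowski_has_inf x).
have gl : g x <= l by apply: (minkowski_le l0 Ky).
exists y; split => //.
rewrite (_ : y = l^-1 *: x).
  by apply: eU; rewrite /ball/= ler0_norm ?subr_le0// opprB ltrBlDl.
by rewrite -xE scalerA mulVf ?scale1r// gt_eqF// (lt_le_trans gx0).
Qed.

Lemma minkowski_le1 y : K y -> g y <= 1.
Proof. by move=> Ky; apply: (@minkowski_le _ _ y) => //; rewrite scale1r. Qed.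

(** At an interior point one could scale up and stay in [K], contradicting the
    minimality of [g x]. *)
Lemma minkowski_boundary x : x != 0 -> boundary K ((g x)^-1 *: x).
Proof.
move=> x0; have gx0 := minkowski_gt0 x0.
split; first exact/subset_closure/minkowski_attained.
rewrite /interior => Ki.
have /= cl : (fun l : R => l *: x) @ (g x)^-1 --> (g x)^-1 *: x.
  by apply: cvgZl; exact: cvg_id.
have /nbhs_ballP[e /= e0 eU] := cl _ Ki.
have /eU : ball (g x)^-1 e ((g x)^-1 + e / 2).
  by rewrite /ball/= opprD addNKr normrN ger0_norm; lra.
have gi0 : 0 < (g x)^-1 by rewrite invr_gt0.
have l0 : 0 < (g x)^-1 + e / 2 by lra.
move=> /= Kl; have : g x <= ((g x)^-1 + e / 2)^-1.
  apply: (minkowski_le _ Kl); first by rewrite invr_ge0 ltW.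
  by rewrite scalerA mulVf ?scale1r// gt_eqF.
by rewrite -lef_pV2 ?posrE ?invr_gt0// invrK; lra.
Qed.

(** Since [g] is positively homogeneous, these two conditions amount to
    [g x + dotmul q (z - x) <= g z] for all [z]. *)
Definition subgradient x q := (forall z, dotmul q z <= g z) /\ dotmul q x = g x.

(** A subgradient at [x <> 0] is the outer normal [n] at [x / g x], divided by
    [c], its scalar product with that point; [c > 0] because [K] contains a small
    positive multiple of [n]. *)
Lemma subgradient_ex x : exists q, subgradient x q.
Proof.
have [->|x0] := eqVneq x 0.
  by exists 0; split=> [z|]; rewrite dotmul0l ?minkowski_ge0// minkowski_0.
have gx0 := minkowski_gt0 x0.
have [n [[nn1 nK] _]] := smoothK (minkowski_boundary x0).
pose c := dotmul n ((g x)^-1 *: x).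
have nKc y : K y -> dotmul n y <= c.
  by move=> /nK; rewrite dotmulBr subr_le0.
have c0 : 0 < c.
  have [r r0 rK] := minkowski_ball.
  have n0 : 0 < `|n|.
    rewrite normr_gt0; apply/eqP => n0; move: nn1; rewrite n0 dotmul0l => /esym/eqP.
    by rewrite oner_eq0.
  have : K ((r / 2 / `|n|) *: n).
    apply: rK; rewrite normrZ gtr0_norm ?divr_gt0//.
    by rewrite mulfVK ?gt_eqF//; lra.
  move=> /nKc; apply: lt_le_trans; rewrite dotmulZr nn1 mulr1.
  by rewrite !divr_gt0.
exists (c^-1 *: n); split => [z|]; last first.
  have -> : dotmul (c^-1 *: n) x = c^-1 * (c * g x).
    by rewrite dotmulZl /c dotmulZr mulrAC mulVf ?mul1r// gt_eqF.
  by rewrite mulKf// gt_eqF.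
(* It remains to bound dotmul (c^-1 *: n) z by g z, testing n on z / g z. *)
have [->|z0] := eqVneq z 0; first by rewrite dotmulC dotmul0l minkowski_0.
have gz0 := minkowski_gt0 z0.
have := nKc _ (minkowski_attained z0).
by rewrite dotmulZl dotmulZr -ler_pdivlMl ?invr_gt0// invrK ler_pdivrMl// mulrC.
Qed.

(** Conversely, the normalization of a subgradient at [x] is an outer unit normal
    at [x / g x], so that smoothness determines its direction, and the equation
    [dotmul q x = g x] determines its length. *)
Lemma subgradient_uniq x q q' : x != 0 -> subgradient x q -> subgradient x q' -> q = q'.
Proof.
move=> x0; have gx0 := minkowski_gt0 x0.
have [n [_ nuniq]] := smoothK (minkowski_boundary x0).
have key p : subgradient x p -> exists2 a : R, 0 < a & p = a *: n.
  move=> [pg px].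
  have p0 : 0 < dotmul p p.
    rewrite lt_neqAle dotmul_ge0 andbT eq_sym dotmul_eq0; apply/eqP => p0.
    by move: gx0; rewrite -px p0 dotmul0l ltxx.
  have s0 : 0 < Num.sqrt (dotmul p p) by rewrite sqrtr_gt0.
  exists (Num.sqrt (dotmul p p)) => //.
  rewrite [in RHS](nuniq ((Num.sqrt (dotmul p p))^-1 *: p)).
    by rewrite scalerA divff ?scale1r// gt_eqF.
  split=> [|y Ky].
    rewrite dotmulZl dotmulZr mulrA -invfM -expr2 sqr_sqrtr ?mulVf ?gt_eqF//.
    exact: ltW.
  rewrite dotmulZl pmulr_rle0 ?invr_gt0// dotmulBr dotmulZr px mulVf ?gt_eqF//.
  by rewrite subr_le0 (le_trans (pg y))// minkowski_le1.
move=> sq sq'; have [a a0 qE] := key _ sq; have [b b0 q'E] := key _ sq'.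
move: sq.2 sq'.2; rewrite qE q'E !dotmulZl => an bn.
congr (_ *: _); apply: (@mulIf _ (dotmul n x)); last by rewrite an bn.
by apply/eqP => n0; move: gx0; rewrite -an n0 mulr0 ltxx.
Qed.

Definition minkowski_grad x := sval (cid (subgradient_ex x)).

Lemma minkowski_gradP x : subgradient x (minkowski_grad x).
Proof. by rewrite /minkowski_grad; case: cid. Qed.

Lemma minkowski_grad_bounded :
  exists2 C : R, 0 < C & forall x, `|minkowski_grad x| <= C.
Proof.
have [C C0 gC] := minkowski_le_norm; exists C => // x.
rewrite [leLHS]/Num.Def.normr/= mx_normrE; apply: bigmax_le; first exact: ltW.
move=> [j i] _ /=; rewrite ord1.
have nd : `|delta_mx ord0 i : 'rV[R]_N| <= 1.
  rewrite [leLHS]/Num.Def.normr/= mx_normrE; apply: bigmax_le => // -[k l] _ /=.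
  by rewrite mxE; case: (_ && _); rewrite ?normr1 ?normr0.
have [sg _] := minkowski_gradP x.
have := sg (delta_mx ord0 i); have := sg (- delta_mx ord0 i).
rewrite -scaleN1r dotmulZr mulN1r dotmul_delta => s1 s2.
have := gC (delta_mx ord0 i); have := gC (- delta_mx ord0 i); rewrite normrN.
move=> g1 g2; rewrite scaleN1r in s1.
have Cd : C * `|delta_mx ord0 i : 'rV[R]_N| <= C by rewrite ler_piMr// ltW.
by rewrite ler_norml; lra.
Qed.

(** The subgradient at [x] bounds [g x - g y] by a linear function of [x - y]
    with bounded coefficients. *)
Lemma minkowski_lipschitz :
  exists2 C : R, 0 < C & forall x y, `|g x - g y| <= C * `|x - y|.
Proof.
have [C C0 sC] := minkowski_grad_bounded; exists (N%:R * C + 1).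
  by rewrite ltr_wpDl// mulr_ge0// ltW.
have key x y : g x - g y <= (N%:R * C + 1) * `|x - y|.
  have [sg <-] := minkowski_gradP x.
  apply: (@le_trans _ _ (dotmul (minkowski_grad x) (x - y))).
    by rewrite dotmulBr lerD2l lerN2.
  apply: (le_trans (ler_norm _)); apply: (le_trans (norm_dotmul _ _)).
  apply: ler_wpM2r => //; apply: (@le_trans _ _ (N%:R * C)); last by lra.
  exact: ler_wpM2l.
move=> x y; rewrite ler_norml lerNl opprB key andbT.
by rewrite -normrN opprB key.
Qed.

Lemma continuous_minkowski : continuous g.
Proof.
have [C C0 gC] := minkowski_lipschitz.
move=> x; apply/(@cvgrPdist_lt _ _ _ (nbhs x)) => e e0.
have eC : 0 < e / C by rewrite divr_gt0.
apply: filterS (near_dist x eC) => y xy.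
by apply: le_lt_trans (gC _ _) _; rewrite -ltr_pdivlMl// mulrC.
Qed.


(** A cluster point of the subgradients at [y], as [y] tends to [x], is a
    subgradient at [x], so it is the one at [x]; in a compact set, a filter with
    a single cluster point converges to it. *)
Lemma continuous_minkowski_grad x : x != 0 -> {for x, continuous minkowski_grad}.
Proof.
move=> x0.
have [C C0 sC] := minkowski_grad_bounded.
have dotcont z : continuous (fun q : 'rV[R]_N => dotmul q z).
  move=> q; apply: continuous_at_sum => i.
  apply: continuous_atM; last exact: cst_continuous.
  exact: (@coord_continuous _ 1 N ord0 i).
pose V : set 'rV[R]_N := [set q | `|q| <= C + 1].
have cV : compact V by exact: compact_rV_ball.
have FV : \forall y \near x, V (minkowski_grad y).
  by apply: (@nearW _ (nbhs x)) => y; rewrite /V /= (le_trans (sC y))// lerDl.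
have cluster_grad q : cluster (minkowski_grad @ x) q -> q = minkowski_grad x.
  move=> cq; apply: (@subgradient_uniq x) => //; last exact: minkowski_gradP.
  have cle (f : 'rV[R]_N -> R) (a : R) : continuous f ->
      (\forall y \near x, f (minkowski_grad y) <= a) -> f q <= a.
    move=> cf near_fa.
    have : closed [set p | f p <= a].
      rewrite (_ : mkset _ = f @^-1` [set r : R | r <= a]) //.
      by apply: closed_comp => [p _|]; [exact: cf|exact: closed_le].
    by apply => U; exact: (cq [set p | f p <= a]).
  have qg z : dotmul q z <= g z.
    apply: (cle (fun p => dotmul p z) (g z) (dotcont z)); apply: (@nearW _ (nbhs x)) => y.
    by have [] := minkowski_gradP y.
  (* dotmul q x >= g x: for y near x, the values at x and at y of the subgradient
     at y differ by O(|x - y|), and the latter is g y. *)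
  split=> //; apply/eqP; rewrite eq_le qg/=.
  apply/ler_addgt0Pl => e e0; rewrite -lerBlDl -lerN2 opprB.
  have cN : continuous (fun p : 'rV[R]_N => - dotmul p x).
    by move=> p; exact: (@continuous_atN _ _ (fun p => dotmul p x) p (dotcont x p)).
  apply: (cle _ _ cN).
  have [L L0 gL] := minkowski_lipschitz.
  have M0 : 0 < N%:R * C + L by rewrite ltr_wpDl// mulr_ge0// ltW.
  have eM : 0 < e / (N%:R * C + L) by rewrite divr_gt0.
  apply: (@filterS _ (nbhs x) _ _ _ _ (near_dist x eM)) => y xy.
  have [_ sy] := minkowski_gradP y.
  have -> : dotmul (minkowski_grad y) x = g y + dotmul (minkowski_grad y) (x - y).
    by rewrite dotmulBr sy addrC subrK.
  have d1 : `|dotmul (minkowski_grad y) (x - y)| <= N%:R * C * `|x - y|.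
    by apply: (le_trans (norm_dotmul _ _)); rewrite ler_wpM2r// ler_wpM2l.
  have d2 := gL x y.
  have d3 : (N%:R * C + L) * `|x - y| <= e.
    by rewrite mulrC -ler_pdivlMr// ltW.
  rewrite mulrDl in d3.
  move: d1 d2; rewrite !ler_norml => /andP[d11 d12] /andP[d21 d22].
  lra.
apply: (@compact_cluster_set1 _ _ _ V) => //.
- apply/nbhs_ballP; exists 1 => //= q; rewrite -ball_normE /= => xq.
  rewrite /V /= -(subrK (minkowski_grad x) q) (le_trans (ler_normD _ _))//.
  by rewrite addrC lerD// distrC ltW.
- exact: (@fmap_proper_filter _ _ minkowski_grad (nbhs x)).
apply/seteqP; split => [q /cluster_grad //|_ ->].
have [q [Vq cq]] := cV (minkowski_grad @ x)
  (@fmap_proper_filter _ _ minkowski_grad (nbhs x) _) FV.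
by rewrite -(cluster_grad q).
Qed.

(** By the subgradient inequalities at [x] and at [x + h v], the increment of [g]
    lies between [h] times the scalar products of [v] with the two
    subgradients, whatever the sign of [h]. *)
Lemma is_derive_minkowski x v : x != 0 ->
  is_derive x v g (dotmul (minkowski_grad x) v).
Proof.
move=> x0.
have cvg_quot : h^-1 *: (g (h *: v + x) - g x) @[h --> 0^'] -->
    dotmul (minkowski_grad x) v.
  have lin : h *: v + x @[h --> (0 : R)] --> x.
    have : h *: v + x @[h --> (0 : R)] --> 0 *: v + x.
      by apply: cvgD; [apply: cvgZr_tmp; exact: cvg_id|exact: cvg_cst].
    by rewrite scale0r add0r.
  have cs : {for x, continuous (fun y => dotmul (minkowski_grad y) v)}.
    apply: continuous_at_sum => i.
    apply: continuous_atM; last exact: cst_continuous.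
    apply: (@continuous_comp _ _ _ minkowski_grad (fun q : 'rV[R]_N => q ord0 i)).
      exact: continuous_minkowski_grad.
    exact: coord_continuous.
  have cd : dotmul (minkowski_grad (h *: v + x)) v @[h --> (0 : R)] -->
      dotmul (minkowski_grad x) v := cvg_comp _ _ lin cs.
  apply/cvgrPdist_le => e e0.
  have near_e : \forall h \near (0 : R),
      `|dotmul (minkowski_grad x) v - dotmul (minkowski_grad (h *: v + x)) v| <= e.
    by move/cvgrPdist_le : cd => /(_ e e0).
  near=> h.
  have h0 : h != 0 by near: h; exact: nbhs_dnbhs_neq.
  have he : `|dotmul (minkowski_grad x) v - dotmul (minkowski_grad (h *: v + x)) v| <= e.
    by near: h; apply: nbhs_dnbhs; exact: near_e.
  have [sg1 sx] := minkowski_gradP x; have [sg2 sh] := minkowski_gradP (h *: v + x).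
  have := sg1 (h *: v + x); have := sg2 x.
  move: sh; rewrite !dotmulDr !dotmulZr sx => sh up lo.
  set a := dotmul (minkowski_grad x) v in he lo *.
  set b := dotmul (minkowski_grad (h *: v + x)) v in he sh *.
  set d := g _ - g x.
  have loq : h * a <= d by rewrite /d; lra.
  have upq : d <= h * b by rewrite /d; lra.
  have dE : d = h * (h^-1 * d) by rewrite mulrA divff// mul1r.
  rewrite /GRing.scale/=; set c := h^-1 * d in dE *.
  apply: le_trans he; rewrite dE in loq upq.
  have [hp|hn] : 0 < h \/ h < 0 by apply/orP; rewrite -neq_lt eq_sym.
  - rewrite !ler_pM2l// in loq upq.
    by rewrite ler0_norm ?subr_le0// ler0_norm ?subr_le0 ?(le_trans loq)//; lra.
  - rewrite !ler_nM2l// in loq upq.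
    by rewrite ger0_norm ?subr_ge0// ger0_norm ?subr_ge0 ?(le_trans upq)//; lra.
apply: DeriveDef.
  by apply/cvg_ex; exists (dotmul (minkowski_grad x) v).
exact/cvg_lim.
Unshelve. all: by end_near. Qed.

End minkowski.

(** * Directional derivatives *)

Section line.
Variables (R : realType) (N : nat).
Implicit Types (x v : 'rV[R]_N) (f : 'rV[R]_N -> R).

(** A directional derivative is a derivative in one variable; this gives access
    to the chain rule. *)
Lemma is_derive_line f x v (d : R) :
  is_derive x v f d <-> is_derive (0 : R) 1 (fun h : R => f (h *: v + x)) d.
Proof.
have E : 'D_1 (fun h : R => f (h *: v + x)) 0 = 'D_v f x.
  by rewrite -derive1E derive1_line scale0r add0r.
split=> -[df <-]; apply: DeriveDef => //.
  exact: (iffLR (derivable1P f x v)).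
exact: (iffRL (derivable1P f x v)).
Qed.

Lemma is_derive_compR f (phi : R -> R) x v (d e : R) :
  is_derive (f x) 1 phi d -> is_derive x v f e ->
  is_derive x v (fun y => phi (f y)) (d * e).
Proof.
move=> dphi /is_derive_line df; apply/is_derive_line.
apply: (@is_derive1_comp _ phi (fun h : R => f (h *: v + x))) => //.
by rewrite scale0r add0r.
Qed.

Lemma is_derive_coord x v i : is_derive x v (fun y => y ord0 i) (v ord0 i).
Proof.
apply/is_derive_line.
rewrite (_ : (fun h => _) = (fun h : R => v ord0 i * h + x ord0 i)).
  apply: is_derive_eq; rewrite addr0 -[X in _ *: X]/(1 : R).
  by rewrite /GRing.scale/= mulr1.
by apply/funext => h; rewrite !mxE mulrC.
Qed.

Lemma derive_eq0_near f x v : (\forall y \near x, f y = 0) -> is_derive x v f 0.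
Proof.
move=> fx.
apply: (@near_eq_is_derive _ _ _ (cst 0)).
by apply: (@filterS _ (nbhs x) _ _ _ _ fx) => y ->.
Qed.

Lemma Rintegral_sum_eq0 n (f : 'I_n -> 'rV[R]_N -> R) (M : R) :
  (forall i, continuous (f i)) -> (forall i, supported_in_ball (f i) M) ->
  (forall i, \int[lebesgue_rV R N]_x f i x = 0) ->
  \int[lebesgue_rV R N]_x (\sum_(i < n) f i x) = 0.
Proof.
move=> cf fM f0.
elim: n f cf fM f0 => [|n IHn] f cf fM f0.
  under eq_Rintegral do rewrite big_ord0.
  by rewrite Rintegral_cst// mul0r.
under eq_Rintegral do rewrite big_ord_recl.
rewrite RintegralD//; last 2 first.
- exact: (supported_integrable (cf _) (fM _)).
- apply: (@supported_integrable _ _ (fun x => \sum_(i < n) f (lift ord0 i) x) M).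
    by move=> x; apply: continuous_at_sum => i; exact: cf.
  move=> x; apply: contraNT => xM; rewrite big1// => i _; apply/eqP.
  by apply: contraNT xM; exact: fM.
by rewrite f0 add0r IHn.
Qed.

End line.

(** * Test functions *)

Section test_functions.
Variables (R : realType) (N : nat) (Omega : set 'rV[R]_N) (u : 'rV[R]_N -> R).
Hypothesis tu : test_function Omega u.
Implicit Types x : 'rV[R]_N.

Definition tsupport := closure [set x | u x != 0].

Lemma closed_tsupport : closed tsupport.
Proof. exact: closed_closure. Qed.

Lemma tsupport_sub x : tsupport x -> Omega x.
Proof. by have [_ _] := tu; exact. Qed.

Lemma tsupportN x : ~ tsupport x -> u x = 0.
Proof. by move=> nSx; apply/eqP; apply: contra_notT nSx => ux; exact: subset_closure. Qed.

Lemma continuous_test : continuous u.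
Proof. by have [/(_ 0%N)[]] := tu. Qed.

Lemma derivable_test i x : derivable u x (delta_mx ord0 i).
Proof. by have [/(_ 1%N)[_ /(_ i)[]]] := tu. Qed.

Lemma continuous_partial_test i : continuous (partial_derive i u).
Proof. by have [/(_ 1%N)[_ /(_ i)[_ []]]] := tu. Qed.

Lemma near_tsupportN x : ~ tsupport x -> \forall y \near x, ~ tsupport y.
Proof.
move=> nSx; apply: open_nbhs_nbhs; split=> //.
by apply: closed_openC; exact: closed_tsupport.
Qed.

Lemma partial_testN i x : ~ tsupport x -> partial_derive i u x = 0.
Proof.
move=> nSx; have [] // := @derive_eq0_near _ _ u x (delta_mx ord0 i) _.
by apply: (@filterS _ (nbhs x) _ _ _ _ (near_tsupportN nSx)) => y; exact: tsupportN.
Qed.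

Lemma tsupport_bounded : exists M : R, forall x, tsupport x -> `|x| <= M.
Proof.
have [_ cS _] := tu; have [M [_ MS]] := compact_bounded cS.
by exists (`|M| + 1) => x Sx; apply: MS; rewrite // ltr_pwDr// ler_norm.
Qed.

Lemma supported_tsupport (f : 'rV[R]_N -> R) (M : R) :
  (forall x, tsupport x -> `|x| <= M) -> (forall x, ~ tsupport x -> f x = 0) ->
  supported_in_ball f M.
Proof.
move=> SM f0 x fx; apply: SM; apply: contrapT => /f0 fx0.
by rewrite fx0 eqxx in fx.
Qed.

End test_functions.

(** * The radial field and its flux *)

Section field.
Variables (R : realType) (N : nat) (K : set 'rV[R]_N).
Hypotheses (cK : compact K) (K0 : K° 0).
Hypothesis smoothK : smooth_body K.
Variable rho : \bar R.
Local Notation g := (minkowski_fun K).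
Local Notation O := (aball K rho `\ 0).
Implicit Types (x y z v : 'rV[R]_N).

Let p := minkowski_grad cK K0 smoothK.

Let g_gt0 x : O x -> 0 < g x.
Proof. by move=> [_ /eqP x0]; exact: minkowski_gt0. Qed.

Let g_lt x : O x -> ((g x)%:E < rho)%E.
Proof. by case. Qed.

Let cont_g x : {for x, continuous g}.
Proof. exact: (continuous_minkowski cK K0 smoothK). Qed.

Lemma continuous_radial (f : R -> R) x : O x -> C1_open0 rho f ->
  {for x, continuous (fun y => f (g y))}.
Proof.
move=> Ox /(_ _ (g_gt0 Ox) (g_lt Ox))[df _].
apply: (@continuous_comp _ _ _ g f); first exact: cont_g.
exact/differentiable_continuous/derivable1_diffP.
Qed.

Lemma continuous_radial' (f : R -> R) x : O x -> C1_open0 rho f ->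
  {for x, continuous (fun y => derive1 f (g y))}.
Proof.
move=> Ox /(_ _ (g_gt0 Ox) (g_lt Ox))[_ cdf].
exact: (@continuous_comp _ _ _ g (derive1 f)).
Qed.

Lemma continuous_gV x : O x -> {for x, continuous (fun y => (g y)^-1)}.
Proof.
move=> Ox; apply: (@continuousV _ _ g); last exact: cont_g.
by rewrite gt_eqF// g_gt0.
Qed.

Variable H : R -> R.
Hypothesis HC1 : C1_open0 rho H.
Local Notation F := (fun y => H (g y) *: sigma_body K y).

Lemma continuous_field i x : O x -> {for x, continuous (fun y => F y ord0 i)}.
Proof.
move=> Ox; rewrite (_ : (fun y => _) = fun y => H (g y) * ((g y)^-1 * y ord0 i)).
  apply: continuous_atM; first exact: continuous_radial.
  apply: continuous_atM; first exact: continuous_gV.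
  exact: coord_continuous.
by apply/funext => y; rewrite !mxE.
Qed.

(** With [phi r = H r / r], the i-th component of the field is [phi (g x) x_i]
    away from 0; the first factor below is the derivative of [phi] at [g x]. *)
Definition field_partial i x : R :=
  (derive1 H (g x) * (g x)^-1 + H (g x) * (- ((g x)^-1 * (g x)^-1))) *
     p x ord0 i * x ord0 i + H (g x) * (g x)^-1.

Lemma is_derive_field i x : O x ->
  is_derive x (delta_mx ord0 i) (fun y => F y ord0 i) (field_partial i x).
Proof.
move=> Ox; have g0 := g_gt0 Ox.
have [dH _] := HC1 g0 (g_lt Ox).
pose phi (r : R) := H r * r^-1.
have dphi : is_derive (g x) 1 phi
    (derive1 H (g x) * (g x)^-1 + H (g x) * (- ((g x)^-1 * (g x)^-1))).
  have dH1 : is_derive (g x) 1 H (derive1 H (g x)).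
    by rewrite derive1E; exact: DeriveDef.
  have dV : is_derive (g x) 1 (fun r : R => r^-1) (- ((g x)^-1 * (g x)^-1)).
    have := @is_deriveV _ id (g x) 1 1; rewrite gt_eqF// => /(_ isT _) dV.
    apply: (is_derive_eq dV).
    by rewrite /GRing.scale/= mulr1 expr2 invfM.
  apply: (is_derive_eq (is_deriveM dH1 dV)).
  by rewrite /GRing.scale/=; ring.
have dg : is_derive x (delta_mx ord0 i) g (p x ord0 i).
  rewrite -[p x ord0 i]dotmul_delta.
  by apply: is_derive_minkowski; have [_ /eqP] := Ox.
rewrite (_ : (fun y => _) = (fun y => phi (g y)) * (fun y => y ord0 i)); last first.
  by apply/funext => y; rewrite !mxE /phi mulrA.
have dcoord := is_derive_coord x (delta_mx ord0 i) i.
apply: (is_derive_eq (is_deriveM (is_derive_compR dphi dg) dcoord)).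
rewrite mxE !eqxx /GRing.scale/= mulr1 /field_partial /phi.
by ring.
Qed.

Lemma continuous_field_partial i x : O x -> {for x, continuous (field_partial i)}.
Proof.
move=> Ox.
have cH := continuous_radial Ox HC1; have cH' := continuous_radial' Ox HC1.
have cV := continuous_gV Ox.
have cp : {for x, continuous (fun y => p y ord0 i)}.
  apply: (@continuous_comp _ _ _ p (fun q : 'rV[R]_N => q ord0 i)).
    by apply: continuous_minkowski_grad; have [_ /eqP] := Ox.
  exact: coord_continuous.
have cx : {for x, continuous (fun y : 'rV[R]_N => y ord0 i)}.
  exact: coord_continuous.
have cVV := continuous_atN (continuous_atM cV cV).
have c1 := continuous_atD (continuous_atM cH' cV) (continuous_atM cH cVV).
exact: (continuous_atD (continuous_atM (continuous_atM c1 cp) cx)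
  (continuous_atM cH cV)).
Qed.

Lemma divergence_field x : O x ->
  divergence F x = \sum_(i < N) field_partial i x.
Proof.
move=> Ox; apply: eq_bigr => i _.
by have [_ <-] := is_derive_field i Ox.
Qed.

Variable u : 'rV[R]_N -> R.
Hypothesis tu : test_function O u.
Local Notation S := (tsupport u).
Local Notation mu := (lebesgue_rV R N).

Let cont_u x : {for x, continuous u}.
Proof. exact: (continuous_test tu). Qed.

Let cont_du i x : {for x, continuous (partial_derive i u)}.
Proof. exact: (continuous_partial_test tu). Qed.

Lemma continuous_cutoff (f : 'rV[R]_N -> R) :
  (forall x, O x -> {for x, continuous f}) -> (forall x, ~ S x -> f x = 0) ->
  continuous f.
Proof.
move=> cf f0; apply: (@continuous_extend0 _ _ S) => //.
  exact: closed_tsupport.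
by move=> x /(tsupport_sub tu); exact: cf.
Qed.

Lemma cutoff_integrable (f : 'rV[R]_N -> R) :
  (forall x, O x -> {for x, continuous f}) -> (forall x, ~ S x -> f x = 0) ->
  mu.-integrable setT (EFin \o f).
Proof.
move=> cf f0; have [M SM] := tsupport_bounded tu.
apply: (@supported_integrable _ _ _ M); first exact: continuous_cutoff.
exact: supported_tsupport SM f0.
Qed.

Lemma continuous_div_term x : O x ->
  {for x, continuous (fun y => (\sum_(i < N) field_partial i y) * u y ^+ 2)}.
Proof.
move=> Ox; apply: continuous_atM.
  by apply: continuous_at_sum => i; exact: continuous_field_partial.
have cu := @cont_u x.
exact: (continuous_atM cu cu).
Qed.

(** The integrand is the divergence of [u^2 F], whose components are compactly
    supported C^1 functions: off the support of [u] they vanish, and on it [F] is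
    of class C^1. *)
Lemma flux_integral_eq0 :
  \int[mu]_x ((\sum_(i < N) field_partial i x) * u x ^+ 2 +
     2 * \sum_(i < N) F x ord0 i * (u x * partial_derive i u x)) = 0.
Proof.
have [M SM] := tsupport_bounded tu.
pose V i (x : 'rV[R]_N) := F x ord0 i * (u x * u x).
pose dV i (x : 'rV[R]_N) := field_partial i x * (u x * u x) +
  2 * (F x ord0 i * (u x * partial_derive i u x)).
have V0 i x : ~ S x -> V i x = 0 by move=> /tsupportN u0; rewrite /V u0 !mulr0.
have dV0 i x : ~ S x -> dV i x = 0.
  by move=> /tsupportN u0; rewrite /dV u0 !(mul0r, mulr0) addr0.
have isdV i x : is_derive x (delta_mx ord0 i) (V i) (dV i x).
  have [Sx|nSx] := pselect (S x); last first.
    rewrite dV0//; apply: derive_eq0_near.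
    by apply: (@filterS _ (nbhs x) _ _ _ _ (near_tsupportN nSx)) => y; exact: V0.
  have dF := is_derive_field i (tsupport_sub tu Sx).
  have du : is_derive x (delta_mx ord0 i) u (partial_derive i u x).
    by apply: DeriveDef => //; exact: (derivable_test tu).
  apply: (is_derive_eq (is_deriveM dF (is_deriveM du du))).
  rewrite /dV /=; set Fx := (_ *: sigma_body K x) ord0 i.
  rewrite /GRing.scale/= -[(u * u) x]/(u x * u x).
  by ring.
have cV i : continuous (V i).
  apply: continuous_cutoff => [x Ox|x /V0//].
  apply: continuous_atM; first exact: continuous_field.
  have cu := @cont_u x.
  exact: (continuous_atM cu cu).
have cdV i : continuous (dV i).
  apply: continuous_cutoff => [x Ox|x /dV0//].
  have cu := @cont_u x.
  apply: continuous_atD.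
    apply: continuous_atM; first exact: continuous_field_partial.
    exact: (continuous_atM cu cu).
  apply: continuous_atM; first exact: cst_continuous.
  apply: continuous_atM; first exact: continuous_field.
  exact: (continuous_atM cu (@cont_du i x)).
have IdV i : \int[mu]_x dV i x = 0.
  have DV : (fun x => 'D_(delta_mx ord0 i) (V i) x) = dV i.
    by apply/funext => x; have [_ ->] := isdV i x.
  have dVi x : derivable (V i) x (delta_mx ord0 i) by have [] := isdV i x.
  have cD : continuous (fun x => 'D_(delta_mx ord0 i) (V i) x) by rewrite DV.
  rewrite -DV; exact: (Rintegral_derive_eq0 (cV i) dVi cD
    (supported_tsupport SM (V0 i))).
rewrite -[RHS](@Rintegral_sum_eq0 _ _ _ dV M) //; last first.
  by move=> i; exact: supported_tsupport SM (dV0 i).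
apply: eq_Rintegral => x _.
by rewrite mulr_suml mulr_sumr -big_split/=; apply: eq_bigr => i _; rewrite expr2.
Qed.

End field.

(** * Completing the square in L^2 *)

Lemma Rintegral_eq_setT d (T : measurableType d) (R : realType)
    (mu : {measure set T -> \bar R}) (D : set T) (f h : T -> R) :
  (forall x, D x -> f x = h x) -> (forall x, ~ D x -> h x = 0) ->
  \int[mu]_(x in D) f x = \int[mu]_x h x.
Proof.
move=> fh h0; rewrite Rintegral_mkcond; apply: eq_Rintegral => x _.
rewrite patchE; case: ifPn => [|]; first by rewrite inE => /fh.
by rewrite notin_setE => /h0.
Qed.

Lemma sqr_weighted_sum (R : rcfType) (a b X Y : R) : 0 < a -> 0 < b ->
  `|Num.sqrt b * X / Num.sqrt a + Num.sqrt a * Y / Num.sqrt b| ^+ 2 =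
  b / a * X ^+ 2 + (a / b * Y ^+ 2 + 2 * (X * Y)).
Proof.
move=> a0 b0; rewrite real_normK ?num_real//.
have sa0 : Num.sqrt a != 0 by rewrite gt_eqF// sqrtr_gt0.
have sb0 : Num.sqrt b != 0 by rewrite gt_eqF// sqrtr_gt0.
move: (Num.sqrt a) (Num.sqrt b) sa0 sb0 (esym (sqr_sqrtr (ltW a0)))
  (esym (sqr_sqrtr (ltW b0))) => s t s0 t0 -> ->.
by field; rewrite s0 t0.
Qed.

(** With [a] and [b] the norms of [X] and [Y], the square integrates to
    [2 a b + 2 int X Y], and [2 int X Y] is compensated by the integral of [Z]. *)
Lemma mul_L2norm d (T : measurableType d) (R : realType)
    (mu : {measure set T -> \bar R}) (X Y Z : T -> R) :
  mu.-integrable setT (EFin \o (fun x => X x ^+ 2)) ->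
  mu.-integrable setT (EFin \o (fun x => Y x ^+ 2)) ->
  mu.-integrable setT (EFin \o (fun x => X x * Y x)) ->
  mu.-integrable setT (EFin \o Z) ->
  \int[mu]_x (Z x + 2 * (X x * Y x)) = 0 ->
  let a := Num.sqrt (\int[mu]_x X x ^+ 2) in
  let b := Num.sqrt (\int[mu]_x Y x ^+ 2) in
  0 < a -> 0 < b ->
  a * b = 2^-1 * (\int[mu]_x Z x) + 2^-1 * (\int[mu]_x
    `|Num.sqrt b * X x / Num.sqrt a + Num.sqrt a * Y x / Num.sqrt b| ^+ 2).
Proof.
move=> iX iY iXY iZ I0 a b a0 b0.
have IZ (c : R) (f : T -> R) : mu.-integrable setT (EFin \o f) ->
    mu.-integrable setT (EFin \o (fun x => c * f x)).
  exact: integrableZl.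
have aE : \int[mu]_x X x ^+ 2 = a ^+ 2.
  by rewrite sqr_sqrtr// Rintegral_ge0// => x _; exact: sqr_ge0.
have bE : \int[mu]_x Y x ^+ 2 = b ^+ 2.
  by rewrite sqr_sqrtr// Rintegral_ge0// => x _; exact: sqr_ge0.
under [in X in _ + _ * X]eq_Rintegral do rewrite sqr_weighted_sum//.
have i2 := IZ 2 _ iXY; have iY' := IZ (a / b) _ iY; have iX' := IZ (b / a) _ iX.
rewrite RintegralD// in I0.
rewrite RintegralD//; last first.
  exact: (integrableD measurableT iY' i2).
rewrite RintegralD// !RintegralZl// aE bE.
rewrite RintegralZl// in I0.
have a1 : a != 0 by rewrite gt_eqF.
have b1 : b != 0 by rewrite gt_eqF.
have -> : \int[mu]_x Z x = - (2 * \int[mu]_x (X x * Y x)).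
  by apply/eqP; rewrite -addr_eq0 I0.
by field; rewrite a1 b1.
Qed.

Theorem theorem3p2 (R : realType) (N : nat) (K : set 'rV[R]_N) (rho : \bar R)
    (A B H : R -> R) (u : 'rV[R]_N -> R) :
  (2 <= N)%N -> Kss_o K -> (0 < rho)%E ->
  C1_open0 rho A -> C1_open0 rho B -> C1_open0 rho H ->
  (forall r : R, 0 < r -> (r%:E < rho)%E -> H r = A r * B r) ->
  test_function (aball K rho `\ 0) u -> u <> (fun=> 0) ->
  let D := aball K rho in
  let ARu := fun x => A (minkowski_fun K x) * radial_derive K u x in
  let Bu := fun x => B (minkowski_fun K x) * u x in
  0 < L2norm D ARu -> 0 < L2norm D Bu ->
  Num.sqrt (\int[lebesgue_rV R N]_(x in D) `|ARu x| ^+ 2)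
    * Num.sqrt (\int[lebesgue_rV R N]_(x in D)
        (B (minkowski_fun K x) ^+ 2 * u x ^+ 2))
  = 2^-1 * (\int[lebesgue_rV R N]_(x in D)
      (divergence (fun y => H (minkowski_fun K y) *: sigma_body K y) x * u x ^+ 2))
  + 2^-1 * (\int[lebesgue_rV R N]_(x in D)
      `| Num.sqrt (L2norm D Bu) * ARu x / Num.sqrt (L2norm D ARu)
         + Num.sqrt (L2norm D ARu) * Bu x / Num.sqrt (L2norm D Bu) | ^+ 2).
Proof.
move=> _ [[cK _ _] K0 nK _] _ AC BC HC HE tu _ D ARu Bu.
have uN x : ~ tsupport u x -> u x = 0 by exact: tsupportN.
have BuN x : ~ tsupport u x -> Bu x = 0 by move=> /uN ux; rewrite /Bu ux mulr0.
have ARuE x : ARu x = A (minkowski_fun K x) * \sum_(i < N)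
    (partial_derive i u x * ((minkowski_fun K x)^-1 * x ord0 i)).
  by congr (_ * _); apply: eq_bigr => i _; rewrite !mxE.
have ARuN x : ~ tsupport u x -> ARu x = 0.
  move=> nSx; rewrite ARuE big1 ?mulr0// => i _.
  by rewrite partial_testN ?mul0r.
have SD x : tsupport u x -> D x by move=> /(tsupport_sub tu)[].
have offD (f : 'rV[R]_N -> R) : (forall x, ~ tsupport u x -> f x = 0) ->
    forall x, ~ D x -> f x = 0.
  by move=> f0 x nDx; apply: f0 => /SD.
have cARu x : (aball K rho `\ 0) x -> {for x, continuous ARu}.
  move=> Ox; rewrite (_ : ARu = fun x => A (minkowski_fun K x) * \sum_(i < N)
    (partial_derive i u x * ((minkowski_fun K x)^-1 * x ord0 i))); last first.
    exact/funext/ARuE.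
  apply: continuous_atM; first exact: (continuous_radial cK K0 nK Ox AC).
  apply: continuous_at_sum => i.
  apply: continuous_atM; first exact: (continuous_partial_test tu).
  apply: continuous_atM; first exact: (continuous_gV cK K0 nK Ox).
  exact: coord_continuous.
have cBu x : (aball K rho `\ 0) x -> {for x, continuous Bu}.
  move=> Ox; apply: continuous_atM; first exact: (continuous_radial cK K0 nK Ox BC).
  exact: (continuous_test tu).
pose Z x := (\sum_(i < N) field_partial cK K0 nK H i x) * u x ^+ 2.
have ZN x : ~ tsupport u x -> Z x = 0.
  by move=> /uN ux; rewrite /Z ux expr0n mulr0.
have intX2 : (lebesgue_rV R N).-integrable setT (EFin \o (fun x => ARu x ^+ 2)).
  apply: (cutoff_integrable tu) => [x Ox|x /ARuN ->]; last by rewrite expr0n.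
  exact: (continuous_atM (cARu x Ox) (cARu x Ox)).
have intY2 : (lebesgue_rV R N).-integrable setT (EFin \o (fun x => Bu x ^+ 2)).
  apply: (cutoff_integrable tu) => [x Ox|x /BuN ->]; last by rewrite expr0n.
  exact: (continuous_atM (cBu x Ox) (cBu x Ox)).
have intXY : (lebesgue_rV R N).-integrable setT (EFin \o (fun x => ARu x * Bu x)).
  apply: (cutoff_integrable tu) => [x Ox|x /BuN ->]; last by rewrite mulr0.
  exact: (continuous_atM (cARu x Ox) (cBu x Ox)).
have intZ : (lebesgue_rV R N).-integrable setT (EFin \o Z).
  apply: (cutoff_integrable tu) => // x Ox.
  exact: (@continuous_div_term _ _ _ cK K0 nK _ _ HC _ tu _ Ox).
have flux : \int[lebesgue_rV R N]_x (Z x + 2 * (ARu x * Bu x)) = 0.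
  rewrite -[RHS](@flux_integral_eq0 _ _ _ cK K0 nK _ _ HC _ tu).
  apply: eq_Rintegral => x _.
  congr (_ + 2 * _); have [Sx|nSx] := pselect (tsupport u x); last first.
    by rewrite BuN// mulr0 big1// => i _; rewrite uN// mul0r mulr0.
  have [Dx /eqP x0] := tsupport_sub tu Sx.
  transitivity (H (minkowski_fun K x) * u x * \sum_(i < N)
      (partial_derive i u x * ((minkowski_fun K x)^-1 * x ord0 i))).
    by rewrite HE ?minkowski_gt0// ARuE /Bu; ring.
  by rewrite mulr_sumr; apply: eq_bigr => i _; rewrite !mxE; ring.
have XE : \int[lebesgue_rV R N]_(x in D) `|ARu x| ^+ 2 =
    \int[lebesgue_rV R N]_x ARu x ^+ 2.
  apply: Rintegral_eq_setT => [x _|]; first by rewrite real_normK ?num_real.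
  by apply: offD => x /ARuN ->; rewrite expr0n.
have YE : \int[lebesgue_rV R N]_(x in D) `|Bu x| ^+ 2 =
    \int[lebesgue_rV R N]_x Bu x ^+ 2.
  apply: Rintegral_eq_setT => [x _|]; first by rewrite real_normK ?num_real.
  by apply: offD => x /BuN ->; rewrite expr0n.
have YE' : \int[lebesgue_rV R N]_(x in D)
    (B (minkowski_fun K x) ^+ 2 * u x ^+ 2) = \int[lebesgue_rV R N]_x Bu x ^+ 2.
  apply: Rintegral_eq_setT => [x _|]; first by rewrite /Bu exprMn.
  by apply: offD => x /BuN ->; rewrite expr0n.
have ZE : \int[lebesgue_rV R N]_(x in D)
    (divergence (fun y => H (minkowski_fun K y) *: sigma_body K y) x * u x ^+ 2) =
    \int[lebesgue_rV R N]_x Z x.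
  apply: Rintegral_eq_setT => [x Dx|]; last exact: offD.
  have [Sx|nSx] := pselect (tsupport u x); last by rewrite /Z uN// expr0n !mulr0.
  by rewrite (@divergence_field _ _ _ cK K0 nK _ _ HC _ (tsupport_sub tu Sx)).
rewrite /L2norm XE YE YE' ZE => a0 b0.
rewrite (@Rintegral_eq_setT _ _ _ _ D _ (fun x => `|Num.sqrt (Num.sqrt
    (\int[lebesgue_rV R N]_x Bu x ^+ 2)) * ARu x /
    Num.sqrt (Num.sqrt (\int[lebesgue_rV R N]_x ARu x ^+ 2)) +
    Num.sqrt (Num.sqrt (\int[lebesgue_rV R N]_x ARu x ^+ 2)) * Bu x /
    Num.sqrt (Num.sqrt (\int[lebesgue_rV R N]_x Bu x ^+ 2))| ^+ 2))//.
  exact: mul_L2norm.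
apply: offD => x nSx.
by rewrite ARuN// BuN// !(mulr0, mul0r) addr0 normr0 expr0n.
Qed.
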